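(* Let $\beta>1$, $\gamma>0$ and $\top>0$. There exist constants $c_1,c_2,c_3>0$, depending only on $\beta,\gamma,\top$, such that the following holds. Let $X$ be a random variable with $\mathbb{E}[\exp(\gamma|X|^\beta)]<\top<\infty$, and let $\phi:\mathbb{R}\to\mathbb{R}$ be a nondecreasing, convex, $L$-Lipschitz disutility function, $L>0$ (for which the OCE risk takes finite values). Then, for every $\epsilon>0$ and $n\ge1$, $$\mathbb{P}\left(|\mathrm{oce}_n-\mathrm{oce}_\phi(X)|>\epsilon\right)\le c_1\left[\exp\left(-c_2n(\epsilon/L)^2\right)\mathbf 1\{\epsilon\le L\}+\exp\left(-c_3n(\epsilon/L)^\beta\right)\mathbf 1\{\epsilon>L\}\right].$$
   Context: The optimized certainty equivalent (OCE) risk of $X$ determined by $\phi$ is $\mathrm{oce}_\phi(X)=\inf_{\xi\in\mathbb{R}}\{\xi+\mathbb{E}[\phi(X-\xi)]\}$. Given i.i.d. samples $X_1,\dots,X_n$ from the distribution of $X$, its empirical estimate is $\mathrm{oce}_n=\inf_{\xi\in\mathbb{R}}\left\{\xi+\frac1n\sum_{i=1}^n\phi(X_i-\xi)\right\}$. (Conditional Value-at-Risk at level $\alpha\in(0,1)$ is the special case $\phi(x)=(1-\alpha)^{-1}\max\{x,0\}$, $L=(1-\alpha)^{-1}$.) *)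

(* Defs.v *)
From HB Require Import structures.
From mathcomp Require Export all_boot all_order all_algebra.
From mathcomp Require Export all_classical all_reals all_analysis.
Export numFieldNormedType.Exports.

Set Implicit Arguments.
Unset Strict Implicit.
Unset Printing Implicit Defensive.

Import Order.TTheory GRing.Theory Num.Theory.

Local Open Scope classical_set_scope.
Local Open Scope ring_scope.
Local Open Scope ereal_scope.

(* The infima are taken in the extended reals, so that no value is silently
   assigned to an infimum that is not finite. *)
Definition oce d (T : measurableType d) (R : realType) (P : probability T R)
    (phi : R -> R) (X : T -> R) : \bar R :=
  ereal_inf (range (fun xi : R =>
    xi%:E + 'E_P[fun w => phi (X w - xi)%R])).

Definition oce_emp (R : realType) (phi : R -> R) (n : nat) (x : 'I_n -> R) :
    \bar R :=
  ereal_inf (range (fun xi : R =>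
    (xi + n%:R^-1 * \sum_(i < n) phi (x i - xi))%R%:E)).

(* Equality is required on measurable sets only: the value of a measure on a
   non-measurable set is unspecified. *)
Definition same_distribution d d' (T : measurableType d)
    (T' : measurableType d') (R : realType) (P : probability T R)
    (P' : probability T' R) (X : {RV P >-> R}) (Y : {RV P' >-> R}) : Prop :=
  forall B : set R, measurable B -> distribution P X B = distribution P' Y B.

Definition mutually_independent d (T : measurableType d) (R : realType)
    (P : probability T R) (I : finType) (X : I -> {RV P >-> R}) : Prop :=
  forall (J : {set I}) (B : I -> set R),
    (forall i, measurable (B i)) ->
    P (\bigcap_(i in [set` J]) (X i @^-1` B i)) =
      \prod_(i in J) P (X i @^-1` B i).

(* Main.v *)
Require Import Defs.
From mathcomp Require Import ring lra measurable_realfun.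
Set Implicit Arguments.
Unset Strict Implicit.
Unset Printing Implicit Defensive.
Import Order.TTheory GRing.Theory Num.Theory.
Local Open Scope classical_set_scope.
Local Open Scope ring_scope.

(* On a grid of step h, an L-Lipschitz function is a combination of indicators
   of half-lines with coefficients at most L h, up to an error L h and a
   truncation error. Hence |oce_n - oce| <= L (Z + small errors), where
   Z = h * sum_j |P_n(X >= t_j) - P(X >= t_j)| is a discretized Wasserstein
   distance between the empirical law P_n and P; since Z does not depend on xi,
   no chaining over xi is needed.

   Jensen's inequality with weights v_j of total mass 1 bounds E exp(lam n Z) by
   the v_j-average of E exp(s_j n |P_n(X >= t_j) - P(X >= t_j)|), with
   s_j = lam h / v_j, and each of these is controlled by the moment generating
   function of a single Bernoulli variable. Taking 1/v_j proportional to
   max(1, (|t_j|/rho)^beta) makes s_j at most gamma |t_j|^beta / 2 in the tail,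
   so that the tail bound exp(- gamma |t|^beta) on the variance absorbs exp(2 s_j),
   whereas the v_j are summable because beta > 1. A fixed rho and lam of order
   eps/L give the Gaussian regime; rho of order eps/L and lam of order
   (eps/L)^(beta - 1) give the exponent (eps/L)^beta. *)

(** * Real inequalities *)

Lemma ln_le_sub1 (R : realType) (y : R) : 0 < y -> ln y <= y - 1.
Proof.
move=> y0; rewrite -ler_expR lnK ?posrE//.
by have := expR_ge1Dx (y - 1); rewrite addrC subrK.
Qed.

(* Mean value inequality for [u |-> u `^ (1 - b)], whose derivative is
   [- (b - 1) * u `^ (- b)]. *)
Lemma powR_telescope (R : realType) (b a u : R) : 1 < b -> 0 < a -> a <= u ->
  (b - 1) * ((u - a) * u `^ (- b)) <= a `^ (1 - b) - u `^ (1 - b).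
Proof.
move=> b1 a0 au; have u0 : 0 < u by apply: lt_le_trans au.
have au0 : 0 < a / u by rewrite divr_gt0.
have -> : a `^ (1 - b) = u `^ (1 - b) * (a / u) `^ (1 - b).
  by rewrite -powRM ?ltW// mulrCA divff ?mulr1// gt_eqF.
have uE : u `^ (1 - b) = u * u `^ (- b).
  by rewrite powRD ?(gt_eqF u0) ?implybT// powRr1 ?(ltW u0).
have h : 1 + (b - 1) * (1 - a / u) <= (a / u) `^ (1 - b).
  rewrite /powR gt_eqF//; apply: le_trans (expR_ge1Dx _).
  by have := ln_le_sub1 au0; nra.
have := ler_wpM2l (powR_ge0 u (1 - b)) h; rewrite uE.
have -> : u * u `^ (- b) * (1 + (b - 1) * (1 - a / u)) =
  u * u `^ (- b) + (b - 1) * ((u - a) * u `^ (- b)) by field; rewrite gt_eqF.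
lra.
Qed.

(* The weight of the grid point [t] is proportional to
   [(profile b (`|t| / rho))^-1]. *)
Definition profile (R : realType) (b u : R) : R := Num.max 1 (u `^ b).

Lemma profile_ge1 (R : realType) (b u : R) : 1 <= profile b u.
Proof. by rewrite /profile le_max lexx. Qed.

Lemma profile_gt0 (R : realType) (b u : R) : 0 < profile b u.
Proof. exact: lt_le_trans ltr01 (profile_ge1 _ _). Qed.

(** Riemann sum of [1 / profile]: the part below 1 contributes at most 1 and the tail telescopes to
    at most [(b - 1)^-1], the integral of [u ^ (- b)] from 1 on. The bound depends neither on the
    mesh [1 / m] nor on [K]. *)
Lemma sum_profile (R : realType) (b : R) (m K : nat) : 1 < b -> (0 < m)%N ->
  \sum_(i < K) (m%:R * profile b (i.+1%:R / m%:R))^-1 <= 1 + (b - 1)^-1.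
Proof.
move=> b1 m0; have mR : 0 < m%:R :> R by rewrite ltr0n.
have b10 : 0 < b - 1 by rewrite subr_gt0.
have F0 i : 0 <= (m%:R * profile b (i.+1%:R / m%:R))^-1.
  by rewrite invr_ge0 mulr_ge0// ltW// profile_gt0.
(* Starting the induction at length [m] puts the points with argument at most 1 in the base case;
   the subtracted power is what [powR_telescope] consumes at each later step. *)
suff H l : \sum_(i < m + l) (m%:R * profile b (i.+1%:R / m%:R))^-1 <=
    1 + (b - 1)^-1 * (1 - ((m + l)%:R / m%:R) `^ (1 - b)).
  apply: (@le_trans _ _ (\sum_(i < m + K) (m%:R * profile b (i.+1%:R / m%:R))^-1)).
    rewrite addnC big_split_ord/= lerDl sumr_ge0// => i _; exact: (F0 (K + i)%N).
  apply: (le_trans (H K)); by rewrite lerD2l ler_piMr ?invr_ge0 ?(ltW b10)// gerBl powR_ge0.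
elim: l => [|l IH].
  rewrite addn0 divff ?gt_eqF// powR1 subrr mulr0 addr0.
  apply: (@le_trans _ _ (\sum_(i < m) (m%:R)^-1)).
    apply: ler_sum => i _; rewrite lef_pV2 ?posrE ?mulr_gt0 ?profile_gt0//.
    by rewrite ler_peMr ?profile_ge1// ltW.
  by rewrite sumr_const card_ord -[_ *+ _]mulr_natr mulVf ?gt_eqF.
rewrite addnS big_ord_recr/=; apply: (le_trans (lerD IH (lexx _))).
set a := (m + l)%:R / m%:R; set u := (m + l).+1%:R / m%:R.
have a1 : 1 <= a by rewrite ler_pdivlMr// mul1r ler_nat leq_addr.
have uE : u - a = m%:R^-1 by rewrite /u /a -natr1; field; rewrite gt_eqF.
have au : a <= u by rewrite -subr_ge0 uE invr_ge0 ltW.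
have u1 : 1 <= u by apply: le_trans au.
have -> : profile b u = u `^ b.
  rewrite /profile; apply/max_idPr.
  by rewrite -(powRr0 u); apply: ler_powR => //; lra.
have := powR_telescope b1 (lt_le_trans ltr01 a1) au.
rewrite uE powRN invfM -(ler_pM2l (x := (b - 1)^-1)) ?invr_gt0//.
by rewrite [leLHS]mulrA mulVf ?gt_eqF// mul1r; lra.
Qed.

(* [step f a h m] is [f] sampled at the largest grid point [a + j * h], [j <= m],
   below [x], written as a telescoping sum of indicators. *)
Definition step (R : realType) (f : R -> R) (a h : R) (m : nat) (x : R) : R :=
  f a + \sum_(j < m) (f (a + j.+1%:R * h) - f (a + j%:R * h)) *
                     (a + j.+1%:R * h <= x)%R%:R.

(** Inside the grid [x] lies within [h] of the grid point below it; outside, [step] is constant and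
    the error is [L] times the distance to the nearest end of the grid. *)
Lemma step_approx (R : realType) (f : R -> R) (L a h : R) (m : nat) (x : R) :
  0 <= L -> 0 < h -> (forall x y, `|f x - f y| <= L * `|x - y|) ->
  `|f x - step f a h m x| <=
    L * (h + Num.max 0 (a - x) + Num.max 0 (x - (a + m%:R * h))).
Proof.
move=> L0 h0 fL.
have top k : a + k%:R * h <= x -> step f a h k x = f (a + k%:R * h).
  elim: k => [|k IH]; first by rewrite mul0r addr0 /step big_ord0 addr0.
  move=> kx; rewrite /step big_ord_recr/= kx mulr1 addrA.
  rewrite -/(step f a h k x) IH; first by rewrite addrC subrK.
  by apply: le_trans kx; rewrite lerD2l ler_pM2r// ler_nat.
have m1 (y : R) : 0 <= Num.max 0 y by rewrite le_max lexx.
have m2 (y : R) : y <= Num.max 0 y by rewrite le_max lexx orbT.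
have [mx|xm] := leP (a + m%:R * h) x.
  rewrite top//; apply: (le_trans (fL _ _)); rewrite ler_wpM2l//.
  rewrite ger0_norm ?subr_ge0//.
  by have := m1 (a - x); have := m2 (x - (a + m%:R * h)); lra.
(* Left of the last grid point there is no overshoot on the right: induction on [m] discards the
   cells above [x], whose indicators vanish. *)
apply: (@le_trans _ _ (L * (h + Num.max 0 (a - x)))); last first.
  by rewrite ler_wpM2l// lerDl.
elim: m xm => [|k IH] xk.
  rewrite /step big_ord0 addr0; apply: (le_trans (fL _ _)); rewrite ler_wpM2l//.
  rewrite ltr0_norm; last lra.
  by have := m2 (a - x); lra.
have -> : step f a h k.+1 x = step f a h k x.
  by rewrite /step big_ord_recr/= [in X in _ + (_ + X)]leNgt xk mulr0 addr0.
have [kx|] := leP (a + k%:R * h) x; last exact: IH.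
rewrite top//; apply: (le_trans (fL _ _)); rewrite ler_wpM2l//.
rewrite ger0_norm ?subr_ge0//.
have := m1 (a - x); move: xk; rewrite -natr1 mulrDl mul1r; lra.
Qed.

(** Averaging the tangent line of [expR] at the mean [M] gives back [expR M], and [expR] lies above
    that tangent. *)
Lemma expR_convex_sum (R : realType) (I : finType) (v y : I -> R) :
  (forall i, 0 <= v i) -> \sum_i v i = 1 ->
  expR (\sum_i v i * y i) <= \sum_i v i * expR (y i).
Proof.
move=> v0 v1; set M := \sum_i v i * y i.
have -> : expR M = \sum_i v i * (expR M * (1 + (y i - M))).
  transitivity (expR M * (\sum_i v i + (\sum_i v i * y i - M * \sum_i v i))).
    by rewrite v1 mulr1 subrr addr0 mulr1.
  rewrite (mulr_sumr _ _ _ M) -sumrB -big_split/= mulr_sumr.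
  by apply: eq_bigr => i _; ring.
apply: ler_sum => i _; rewrite ler_wpM2l//.
rewrite -[in leRHS](subrK M (y i)) expRD mulrC ler_wpM2r ?expR_ge0//.
exact: expR_ge1Dx.
Qed.

(** For [p] above one half, the centred variable is rewritten through the complementary event of
    probability [r = 1 - p], with [- s] in place of [s]. The factor [Num.min p (1 - p)] makes the
    bound small in both tails of the grid. *)
Lemma bernoulli_mgf (R : realType) (p s : R) : 0 <= p <= 1 -> 0 <= s ->
  expR (- (s * p)) * (1 + p * (expR s - 1)) <=
    expR (Num.min p (1 - p) * (s ^+ 2 * expR s)).
Proof.
move=> /andP[p0 p1] s0.
have es : 0 < expR s := expR_gt0 s.
have e1 : expR s - 1 - s <= s ^+ 2 * expR s.
  have : expR s * expR (- s) = 1 by rewrite -expRD subrr expR0.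
  have := ler_wpM2l (ltW es) (expR_ge1Dx (- s)) => h1 h2.
  have h3 : expR s - 1 <= s * expR s by lra.
  by have := ler_wpM2l s0 h3; rewrite expr2; lra.
have [pq|qp] := leP p (1 - p).
  apply: (@le_trans _ _ (expR (- (s * p)) * expR (p * (expR s - 1)))).
    by rewrite ler_wpM2l ?expR_ge0// expR_ge1Dx.
  by rewrite -expRD ler_expR; nra.
set r := 1 - p.
have -> : expR (- (s * p)) * (1 + p * (expR s - 1)) =
    expR (s * r) * (1 + r * (expR (- s) - 1)).
  have -> : - (s * p) = s * r - s by rewrite /r; ring.
  rewrite expRD; have : expR (- s) * expR s = 1 by rewrite -expRD addNr expR0.
  move=> e; rewrite -mulrA; congr (_ * _).
  have -> : expR (- s) * (1 + p * (expR s - 1)) =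
    expR (- s) + p * (expR (- s) * expR s) - p * expR (- s) by ring.
  by rewrite e /r; ring.
apply: (@le_trans _ _ (expR (s * r) * expR (r * (expR (- s) - 1)))).
  by rewrite ler_wpM2l ?expR_ge0// expR_ge1Dx.
rewrite -expRD ler_expR.
have r0 : 0 <= r by rewrite subr_ge0.
have e2 : expR (- s) - 1 + s <= s ^+ 2 * expR s.
  (* Here [expR (- s) <= (1 + s)^-1 <= 1 - s + s ^+ 2]. *)
  rewrite expRN; have s1 := expR_ge1Dx s.
  apply: (@le_trans _ _ (s ^+ 2)); last by rewrite ler_peMr ?sqr_ge0//; lra.
  have : (expR s)^-1 <= (1 + s)^-1 by rewrite lef_pV2 ?posrE//; lra.
  suff : (1 + s)^-1 <= 1 - s + s ^+ 2 by lra.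
  rewrite -[leLHS]mul1r ler_pdivrMr; last lra.
  by rewrite expr2; nra.
by have := ler_wpM2l r0 e2; lra.
Qed.

Lemma bernoulli_mgf_le (R : realType) (p s : R) : 0 <= p <= 1 -> 0 <= s ->
  expR (- (s * p)) * (1 + p * (expR s - 1)) <= expR s.
Proof.
move=> /andP[p0 p1] s0; rewrite -[leRHS]mul1r; apply: ler_pM.
- exact: expR_ge0.
- by have := expR_ge1Dx s; nra.
- by rewrite -[leRHS]expR0 ler_expR oppr_le0 mulr_ge0.
- by have := expR_ge1Dx s; nra.
Qed.

(** This is the square of [y - 2 * M] being nonnegative; it turns truncation errors into second
    moments. *)
Lemma pos_part_le (R : realType) (y M : R) : 0 < M ->
  Num.max 0 (y - M) <= y ^+ 2 / (4 * M).
Proof.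
move=> M0; rewrite ge_max divr_ge0 ?sqr_ge0 ?mulr_ge0 ?(ltW M0)//=.
rewrite ler_pdivlMr ?mulr_gt0//.
by have := sqr_ge0 (y - 2 * M); rewrite !expr2; lra.
Qed.

Lemma measurable_superlevel d (S : measurableType d) (R : realType)
    (f : S -> R) (c : R) :
  measurable_fun setT f -> measurable [set w | c <= f w].
Proof.
move=> mf; rewrite -[X in measurable X]setTI.
exact: (measurable_fun_le (f := cst c)).
Qed.

Lemma markov_ge0 d (S : measurableType d) (R : realType)
    (Q : probability S R) (f : S -> R) (c : R) :
  measurable_fun setT f -> (forall w, 0 <= f w) -> 0 < c ->
  (Q [set w | (c <= f w)%R] <= (c^-1)%:E * \int[Q]_w (f w)%:E)%E.
Proof.
move=> mf f0 c0.
have mA : measurable [set w | c <= f w] by exact: measurable_superlevel.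
have m1 : measurable_fun setT (fun w => (\1_[set w | c <= f w] w : R)%:E).
  by apply/measurable_EFinP; exact: measurable_indic.
rewrite lee_pdivlMl// -[X in Q X]setIT -integral_indic// -ge0_integralZl//; last first.
  by rewrite lee_fin ltW.
apply: ge0_le_integral => //.
- by move=> w _; rewrite mule_ge0// lee_fin// ltW.
- exact: measurable_funeM.
- exact/measurable_EFinP.
- move=> w _; rewrite -EFinM lee_fin indicE.
  have [/set_mem|_] := boolP (_ \in _); last by rewrite mulr0.
  by rewrite mulr1.
Qed.

(** * Exponential moments of counts of independent events *)

Section independent_indicators.
Context d (S : measurableType d) (R : realType) (Q : probability S R).
Variables (n : nat) (Xs : 'I_n -> {RV Q >-> R}).
Hypothesis Xs_indep : mutually_independent Xs.

(* Expanding the product over subsets reduces the factorization to the product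
   rule for events: no joint law of the sample is needed. *)
Lemma integral_prod_indic (B : set R) (p a : R) : measurable B ->
  (forall i, Q (Xs i @^-1` B) = p%:E) -> 0 <= a ->
  (\int[Q]_w (\prod_(i < n) (1 + a * \1_B (Xs i w)))%:E =
     ((1 + a * p) ^+ n)%:E)%E.
Proof.
move=> mB QB a0.
have mX i : measurable (Xs i @^-1` B).
  by rewrite -[_ @^-1` _]setTI; exact: measurable_funP.
pose C (J : {set 'I_n}) : set S := \bigcap_(i in [set` J]) (Xs i @^-1` B).
have mC J : measurable (C J).
  by apply: fin_bigcap_measurable => // i _; exact: mX.
have CE (J : {set 'I_n}) w : \prod_(i in J) \1_B (Xs i w) = \1_(C J) w :> R.
  have [wC|wC] := pselect (C J w).
    rewrite [RHS]indicE mem_set//= big1// => i iJ.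
    by rewrite indicE mem_set//; exact: (wC i).
  rewrite [RHS]indicE memNset//=.
  have [i iJ iB] : exists2 i, i \in J & ~ B (Xs i w).
    apply: contrapT => h; apply: wC => i /= iJ; apply: contrapT => iB.
    by apply: h; exists i.
  by rewrite (bigD1 i)//= indicE memNset//= mul0r.
under eq_integral => w _.
  under eq_bigr do rewrite addrC.
  rewrite bigA_distr/= -sumEFin.
  under eq_bigr => J _.
    rewrite -big_mkcond/= big_split/= CE prodr_const EFinM.
    over.
  over.
rewrite ge0_integral_sum//=; last 2 first.
- move=> J; apply: measurable_funeM; apply/measurable_EFinP.
  exact: measurable_indic.
- by move=> J w _; rewrite mule_ge0// lee_fin ?exprn_ge0.
transitivity (\sum_(J in {set 'I_n}) (\prod_(i in J) (a * p))%:E)%E.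
  apply: eq_bigr => J _; rewrite ge0_integralZl//=; last 2 first.
  - by apply/measurable_EFinP; exact: measurable_indic.
  - by rewrite lee_fin exprn_ge0.
  have -> : (\int[Q]_x (\1_(C J) x)%:E = \prod_(i in J) Q (Xs i @^-1` B))%E.
    rewrite integral_indic// setIT; exact: (Xs_indep J (fun=> mB)).
  rewrite (eq_bigr (fun=> p%:E)) => [|i _]; last exact: QB.
  rewrite big_split/= EFinM prodr_const; congr (_ * _)%E.
  by apply: (big_ind2 (fun (x : \bar R) y => x = y%:E)) => // x1 x2 y1 y2 -> ->.
rewrite sumEFin; congr (_%:E).
have /esym := @bigA_distr R 0 1 *%R +%R 'I_n (fun=> a * p) (fun=> 1).
under eq_bigr do rewrite -big_mkcond/=.
by move=> ->; rewrite prodr_const card_ord addrC.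
Qed.

Lemma measurable_count (B : set R) : measurable B ->
  measurable_fun setT (fun w => \sum_(i < n) \1_B (Xs i w) : R).
Proof.
move=> mB; apply: measurable_sum => i.
by apply: measurableT_comp => //; exact: measurable_indic.
Qed.

(** An indicator takes only the values 0 and 1, so [expR (s * \1_B x)] is the affine expression
    [1 + (expR s - 1) * \1_B x], and [integral_prod_indic] applies. *)
Lemma count_mgf (B : set R) (p s : R) : measurable B ->
  (forall i, Q (Xs i @^-1` B) = p%:E) -> 0 <= s ->
  (\int[Q]_w (expR (s * (\sum_(i < n) \1_B (Xs i w) - n%:R * p)))%:E =
     ((expR (- (s * p)) * (1 + p * (expR s - 1))) ^+ n)%:E)%E.
Proof.
move=> mB QB s0.
have E w : expR (s * (\sum_(i < n) \1_B (Xs i w) - n%:R * p)) =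
    expR (- (s * p)) ^+ n * \prod_(i < n) (1 + (expR s - 1) * \1_B (Xs i w)).
  have -> : s * (\sum_(i < n) \1_B (Xs i w) - n%:R * p) =
    n%:R * (- (s * p)) + \sum_(i < n) s * \1_B (Xs i w).
    by rewrite -mulr_sumr; ring.
  rewrite expRD expRM_natl expR_sum; congr (_ * _); apply: eq_bigr => i _.
  rewrite indicE; case: (_ \in _); rewrite /= ?mulr1 ?mulr0 ?expR0 ?addr0//.
  by rewrite addrC subrK.
under eq_integral do rewrite E EFinM.
have es : 0 <= expR s - 1 by rewrite subr_ge0 -expR0 ler_expR.
rewrite ge0_integralZl//=.
- rewrite (integral_prod_indic mB QB es) -EFinM exprMn.
  by rewrite [(expR s - 1) * p]mulrC.
- apply/measurable_EFinP; apply: measurable_prod => i _.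
  apply: measurable_funD => //; apply: measurable_funM => //.
  by apply: measurableT_comp => //; exact: measurable_indic.
- move=> w _; rewrite lee_fin prodr_ge0// => i _.
Qed.

(** The exponential of [|y|] is at most [expR y + expR (- y)], and the negative side is the centred
    count of the complement of [B], with [1 - p] for [p]. Both sides have the same
    [Num.min p (1 - p)]. *)
Lemma count_abs_mgf (B : set R) (p s psi : R) : measurable B ->
  (forall i, Q (Xs i @^-1` B) = p%:E) -> 0 <= p <= 1 -> 0 <= s ->
  Num.min (Num.min p (1 - p) * (s ^+ 2 * expR s)) s <= psi ->
  (\int[Q]_w (expR (s * `|\sum_(i < n) \1_B (Xs i w) - n%:R * p|))%:E <=
     (2 * expR (n%:R * psi))%:E)%E.
Proof.
move=> mB QB p01 s0 psi_ge.
have M r : 0 <= r <= 1 -> Num.min r (1 - r) = Num.min p (1 - p) ->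
    (expR (- (s * r)) * (1 + r * (expR s - 1))) ^+ n <= expR (n%:R * psi).
  move=> r01 rp; rewrite expRM_natl; apply: lerXn2r; rewrite ?nnegrE ?expR_ge0//.
    case/andP: r01 => r0 _; rewrite mulr_ge0 ?expR_ge0 ?addr_ge0 ?mulr_ge0//.
    by rewrite subr_ge0 -expR0 ler_expR.
  apply: le_trans (_ : expR _ <= _); last by rewrite ler_expR; exact: psi_ge.
  rewrite minElt; case: ifP => _; last exact: bernoulli_mgf_le.
  by rewrite -rp; exact: bernoulli_mgf.
have mBc : measurable (~` B) by exact: measurableC.
have QBc i : Q (Xs i @^-1` ~` B) = (1 - p)%:E.
  rewrite preimage_setC probability_setC ?QB//.
  by rewrite -[X in measurable X]setTI; exact: measurable_funP.
have E w : \sum_(i < n) \1_(~` B) (Xs i w) - n%:R * (1 - p) =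
    - (\sum_(i < n) \1_B (Xs i w) - n%:R * p) :> R.
  have -> : \sum_(i < n) \1_(~` B) (Xs i w) =
      \sum_(i < n) (1 - \1_B (Xs i w)) :> R.
    apply: eq_bigr => i _; rewrite !indicE in_setC.
    by case: (_ \in _); rewrite /= ?subrr ?subr0.
  by rewrite sumrB sumr_const card_ord -[_ *+ _]mulr_natr; ring.
have q01 : 0 <= 1 - p <= 1 by case/andP: p01 => *; apply/andP; split; lra.
have mE (D : set R) (r : R) : measurable D ->
  measurable_fun setT
    (fun w => (expR (s * (\sum_(i < n) \1_D (Xs i w) - n%:R * r)))%:E).
  move=> mD; apply/measurable_EFinP; apply: measurableT_comp => //.
  apply: measurable_funM => //; apply: measurable_funB => //.
  exact: measurable_count.
apply: (@le_trans _ _ (\int[Q]_w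
   ((expR (s * (\sum_(i < n) \1_B (Xs i w) - n%:R * p)))%:E +
    (expR (s * (\sum_(i < n) \1_(~` B) (Xs i w) - n%:R * (1 - p))))%:E))%E).
  apply: ge0_le_integral => //.
  - apply/measurable_EFinP; apply: measurableT_comp => //.
    apply: measurable_funM => //; apply: measurableT_comp => //.
    by apply: measurable_funB => //; exact: measurable_count.
  - by apply: emeasurable_funD; exact: mE.
  - move=> w _; rewrite E -EFinD lee_fin.
    have [y0|y0] := lerP 0 (\sum_(i < n) \1_B (Xs i w) - n%:R * p).
      by rewrite ger0_norm// lerDl expR_ge0.
    by rewrite ltr0_norm// lerDr expR_ge0.
rewrite ge0_integralD//=; last 2 first.
- exact: mE.
- exact: mE.
rewrite (count_mgf mB QB s0) (count_mgf mBc QBc s0) -EFinD lee_fin.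
have -> : 2 * expR (n%:R * psi) = expR (n%:R * psi) + expR (n%:R * psi) by ring.
apply: lerD; first exact: M.
by apply: M => //; rewrite subKr minC.
Qed.

(** Chernoff's method: [lam * Z] is the [v]-average of [lam * h / v j * |D j|], so Jensen's
    inequality reduces its exponential moment to single counts. The counts at different [j] are
    dependent, which convexity does not mind. *)
Lemma weighted_count_tail (N : nat) (t p v : 'I_N -> R) (lam h psi y : R) :
  (forall j i, Q (Xs i @^-1` [set x | t j <= x]) = (p j)%:E) ->
  (forall j, 0 <= p j <= 1) -> (forall j, 0 < v j) -> \sum_j v j = 1 ->
  0 < h -> 0 < lam ->
  (forall j, Num.min (Num.min (p j) (1 - p j) *
     ((lam * h / v j) ^+ 2 * expR (lam * h / v j))) (lam * h / v j) <= psi) ->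
  (Q [set w | (y <= h * \sum_(j < N)
        `|\sum_(i < n) \1_[set x | t j <= x] (Xs i w) - n%:R * p j|)%R]
    <= (2 * expR (n%:R * psi - lam * y))%:E)%E.
Proof.
move=> QB p01 v0 v1 h0 lam0 psi_ge.
have mB j : measurable [set x : R | t j <= x].
  exact: (measurable_superlevel (f := id)).
pose D j w := \sum_(i < n) \1_[set x | t j <= x] (Xs i w) - n%:R * p j.
have mD j : measurable_fun setT (D j).
  by apply: measurable_funB => //; exact: measurable_count.
pose Z w := h * \sum_(j < N) `|D j w|.
have mZ : measurable_fun setT Z.
  apply: measurable_funM => //; apply: measurable_sum => j.
  exact: measurableT_comp.
have s0 j : 0 <= lam * h / v j by rewrite divr_ge0 ?mulr_ge0 ?ltW.
have mse j : measurable_fun setT (fun w => (expR (lam * h / v j * `|D j w|))%:E).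
  apply/measurable_EFinP; apply: measurableT_comp => //.
  by apply: measurable_funM => //; exact: measurableT_comp.
have IZ : (\int[Q]_w (expR (lam * Z w))%:E <= (2 * expR (n%:R * psi))%:E)%E.
  apply: (@le_trans _ _ (\int[Q]_w
     (\sum_(j < N) (v j)%:E * (expR (lam * h / v j * `|D j w|))%:E))%E).
    apply: ge0_le_integral => //.
    - apply/measurable_EFinP; apply: measurableT_comp => //.
      exact: measurable_funM.
    - apply: emeasurable_sum => j; apply: measurable_funeM; exact: mse.
    - move=> w _; under eq_bigr do rewrite -EFinM.
      rewrite sumEFin lee_fin.
      have -> : lam * Z w = \sum_(j < N) v j * (lam * h / v j * `|D j w|).
        rewrite /Z mulrA mulr_sumr; apply: eq_bigr => j _.
        by field; rewrite gt_eqF.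
      by apply: expR_convex_sum => // j; rewrite ltW.
  rewrite ge0_integral_sum//=; last 2 first.
  - by move=> j; apply: measurable_funeM; exact: mse.
  - by move=> j w _; rewrite mule_ge0// lee_fin ?expR_ge0 ?ltW.
  apply: (@le_trans _ _ (\sum_(j < N) (v j * (2 * expR (n%:R * psi)))%:E)%E).
    apply: lee_sum => j _; rewrite ge0_integralZl//=; last first.
    - by rewrite lee_fin ltW.
    rewrite EFinM lee_wpmul2l ?lee_fin ?(ltW (v0 j))//.
    exact: (count_abs_mgf (mB j) (QB j)).
  by rewrite sumEFin -mulr_suml v1 mul1r.
have -> : [set w | y <= Z w] = [set w | expR (lam * y) <= expR (lam * Z w)].
  by apply/seteqP; split => w /=; rewrite ler_expR ler_pM2l.
apply: le_trans (markov_ge0 _ _ _ _) _.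
- by apply: measurableT_comp => //; exact: measurable_funM.
- by move=> w; rewrite expR_ge0.
- exact: expR_gt0.
by rewrite expRD expRN mulrA [in leRHS]mulrC EFinM lee_wpmul2l.
Qed.

End independent_indicators.

(** * Bounds on the exponents attached to the grid points *)

Lemma sqr_le_expR (R : realType) (s : R) : 0 <= s -> s ^+ 2 <= 2 * expR s.
Proof. by move=> s0; have := @expR_ge1Dxn R s 1 s0; rewrite (_ : 2`!%:R = 2 :> R)//; lra. Qed.

(* Here [u] is the modulus of a grid point [t], [q] is the minimum of
   [P (X >= t)] and [P (X < t)], and [s] is the exponent which Jensen's
   inequality attaches to [t]. *)
Section exponent_bounds.
Context (R : realType) (b g C0 lam rho top q s u : R).
Hypotheses (b0 : 0 <= b) (C00 : 0 < C0) (lam0 : 0 < lam)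
  (rho0 : 0 < rho) (u0 : 0 <= u) (q0 : 0 <= q) (q1 : q <= 1)
  (q_tail : q <= top * expR (- (g * u `^ b))) (s0 : 0 <= s).

(** Beyond [rho] the profile is a pure power, so the exponent is at most [g * u ^ b], which the
    decay of [q] cancels. The two regimes use it with [a = lam] and [a = 1]. *)
Let tail_bound (a : R) : 2 * (C0 * a * rho) <= g * rho `^ b -> rho < u ->
  q * expR (2 * (C0 * a * rho * profile b (u / rho))) <= top.
Proof.
move=> h ru.
have ub : (u / rho) `^ b * rho `^ b = u `^ b.
  by rewrite -powRM ?divr_ge0 ?(ltW rho0)// -mulrA mulVf ?mulr1 ?gt_eqF.
have -> : profile b (u / rho) = (u / rho) `^ b.
  rewrite /profile; apply/max_idPr; rewrite -(powRr0 (u / rho)).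
  by apply: ler_powR => //; rewrite ler_pdivlMr// mul1r ltW.
have top0 : 0 <= top.
  by rewrite -(pmulr_lge0 _ (expR_gt0 (- (g * u `^ b)))); apply: le_trans q_tail.
apply: (@le_trans _ _ (top * expR (- (g * u `^ b)) * expR (g * u `^ b))).
  apply: ler_pM; rewrite ?expR_ge0// ler_expR -ub.
  by have := ler_wpM2r (powR_ge0 (u / rho) b) h; lra.
by rewrite -mulrA -expRD addNr expR0 mulr1.
Qed.

Let profile1 : u <= rho -> profile b (u / rho) = 1.
Proof.
move=> ur; rewrite /profile; apply/max_idPl.
have := @ge0_ler_powR R b b0 (u / rho) 1; rewrite powR1; apply; rewrite ?nnegrE//.
  by rewrite divr_ge0// ltW.
by rewrite ler_pdivrMr// mul1r.
Qed.

(** For [u <= rho] the profile is 1 and the crude exponent [s] suffices; beyond [rho],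
    [s ^+ 2 * expR s <= 2 * expR (2 * s)] is absorbed by the tail. *)
Lemma exponent_large : 2 * (C0 * lam * rho) <= g * rho `^ b ->
  s <= C0 * lam * rho * profile b (u / rho) ->
  Num.min (q * (s ^+ 2 * expR s)) s <= C0 * lam * rho + 2 * top.
Proof.
move=> h sle; have [ur|ru] := leP u rho.
  rewrite ge_min; apply/orP; right; apply: (le_trans sle).
  rewrite profile1// mulr1 lerDl mulr_ge0//.
  by rewrite -(pmulr_lge0 _ (expR_gt0 (- (g * u `^ b)))); apply: le_trans q_tail.
rewrite ge_min; apply/orP; left.
apply: (@le_trans _ _ (2 * (q * expR (2 * s)))).
  have -> : 2 * (q * expR (2 * s)) = q * (2 * expR s * expR s).
    by rewrite -[2 * expR s * _]mulrA -expRD -[s + s]mulr2n -[s *+ 2]mulr_natl; ring.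
  by rewrite ler_wpM2l// ler_wpM2r ?expR_ge0// sqr_le_expR.
apply: (@le_trans _ _ (2 * top)); last by rewrite lerDr !mulr_ge0 ?ltW.
rewrite ler_pM2l//; apply: le_trans (tail_bound h ru).
by rewrite ler_wpM2l// ler_expR ler_pM2l.
Qed.

(** The variance bound is used at every point: [lam ^+ 2] comes out of the square, while [lam <= 1]
    bounds the exponential by one free of [lam]. A bound quadratic in [lam] is what yields Gaussian
    decay. *)
Lemma exponent_small : lam <= 1 -> 2 * (C0 * rho) <= g * rho `^ b ->
  s <= C0 * lam * rho * profile b (u / rho) ->
  Num.min (q * (s ^+ 2 * expR s)) s <=
    lam ^+ 2 * (2 * (expR (2 * (C0 * rho)) + top)).
Proof.
move=> lam1 h; set A := C0 * rho * profile b (u / rho).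
have -> : C0 * lam * rho * profile b (u / rho) = lam * A by rewrite /A; ring.
move=> sle; rewrite ge_min; apply/orP; left.
have A0 : 0 <= A by rewrite !mulr_ge0 ?ltW// profile_gt0.
have top0 : 0 <= top.
  by rewrite -(pmulr_lge0 _ (expR_gt0 (- (g * u `^ b)))); apply: le_trans q_tail.
apply: (@le_trans _ _ (lam ^+ 2 * (2 * (q * expR (2 * A))))).
  apply: (@le_trans _ _ (q * ((lam * A) ^+ 2 * expR A))).
    rewrite ler_wpM2l// ler_pM ?sqr_ge0 ?expR_ge0//.
      by rewrite lerXn2r ?nnegrE// mulr_ge0// ltW.
    by rewrite ler_expR; apply: (le_trans sle); rewrite ler_piMl.
  have -> : lam ^+ 2 * (2 * (q * expR (2 * A))) =
      lam ^+ 2 * q * (2 * expR A * expR A).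
    by rewrite -[2 * expR A * _]mulrA -expRD -[A + A]mulr2n -[A *+ 2]mulr_natl; ring.
  have -> : q * ((lam * A) ^+ 2 * expR A) = lam ^+ 2 * q * (A ^+ 2 * expR A).
    by rewrite exprMn; ring.
  rewrite (ler_wpM2l (mulr_ge0 (sqr_ge0 lam) q0))//.
  by rewrite ler_wpM2r ?expR_ge0// sqr_le_expR.
rewrite ler_wpM2l ?sqr_ge0// ler_pM2l//.
have [ur|ru] := leP u rho.
  rewrite /A profile1// mulr1 -[leLHS]add0r addrC.
  by apply: lerD => //; rewrite ler_piMl ?expR_ge0.
apply: (@le_trans _ _ top); last by rewrite lerDr expR_ge0.
have := @tail_bound 1 _ ru; rewrite mulr1; exact.
Qed.

End exponent_bounds.

Lemma sqr_le_exp_powR (R : realType) (b g x : R) : 1 < b -> 0 < g ->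
  x ^+ 2 <= 1 + 2 / g ^+ 2 * expR (g * `|x| `^ b).
Proof.
move=> b1 g0; rewrite -real_normK ?num_real//; set y := `|x|.
have y0 : 0 <= y := normr_ge0 x.
have [y1|y1] := leP y 1.
  apply: (@le_trans _ _ 1); first by rewrite -(expr1n _ 2) lerXn2r ?nnegrE.
  by rewrite lerDl mulr_ge0 ?expR_ge0// divr_ge0 ?sqr_ge0.
apply: (@le_trans _ _ (2 / g ^+ 2 * expR (g * y))).
  have := sqr_le_expR (mulr_ge0 (ltW g0) y0).
  rewrite exprMn => H; have g20 : 0 < g ^+ 2 by rewrite exprn_gt0.
  by rewrite -(ler_pM2l g20); apply: (le_trans H); rewrite mulrA mulrCA divff ?mulr1 ?gt_eqF.
apply: (@le_trans _ _ (2 / g ^+ 2 * expR (g * y `^ b))); last by rewrite lerDr.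
rewrite ler_wpM2l ?divr_ge0 ?sqr_ge0// ler_expR ler_pM2l//.
by rewrite -{1}(powRr1 y0); apply: ler_powR; exact: ltW.
Qed.

(** * Tail probabilities and second moment of [X] *)

Section moments.
Context d (T : measurableType d) (R : realType) (P : probability T R).
Variables (X : {RV P >-> R}) (b g top : R).
Hypotheses (b1 : 1 < b) (g0 : 0 < g)
  (hX : ('E_P[fun w => expR (g * `|X w| `^ b)] < top%:E)%E).

Let mexp : measurable_fun setT (fun w => expR (g * `|X w| `^ b)).
Proof.
apply: measurableT_comp => //; apply: measurable_funM => //.
apply: (measurableT_comp (f := (@powR R)^~ b)); first exact: measurable_powR.
exact: measurableT_comp.
Qed.

Lemma tail_prob (u : R) : 0 <= u ->
  (P [set w | (u <= `|X w|)%R] <= (top * expR (- (g * u `^ b)))%:E)%E.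
Proof.
move=> u0.
apply: (@le_trans _ _ (P [set w | expR (g * u `^ b) <= expR (g * `|X w| `^ b)])).
  rewrite le_measure ?inE//.
  - by apply: measurable_superlevel; exact: measurableT_comp.
  - exact: measurable_superlevel.
  - move=> w /= uX; rewrite ler_expR ler_pM2l//.
    by apply: (ge0_ler_powR (ltW (lt_trans ltr01 b1))); rewrite ?nnegrE.
apply: (le_trans (markov_ge0 P mexp _ (expR_gt0 _))).
  by move=> w; rewrite expR_ge0.
rewrite expRN [top * _]mulrC [leRHS]EFinM lee_wpmul2l ?lee_fin ?invr_ge0 ?expR_ge0//.
by move: hX; rewrite unlock => /ltW.
Qed.

Lemma second_moment : (\int[P]_w (X w ^+ 2)%:E <= (1 + 2 / g ^+ 2 * top)%:E)%E.
Proof.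
have c0 : 0 <= 2 / g ^+ 2 by rewrite divr_ge0 ?sqr_ge0.
apply: (@le_trans _ _ (\int[P]_w
    (1 + (2 / g ^+ 2)%:E * (expR (g * `|X w| `^ b))%:E))%E).
  apply: ge0_le_integral => //.
  - by move=> w _; rewrite lee_fin sqr_ge0.
  - by apply/measurable_EFinP; exact: measurable_funX.
  - apply: emeasurable_funD => //; apply: measurable_funeM.
    exact/measurable_EFinP.
  - by move=> w _; rewrite -EFinM -EFinD lee_fin sqr_le_exp_powR.
rewrite ge0_integralD//=; last 2 first.
- by move=> w _; rewrite mule_ge0// lee_fin expR_ge0.
- by apply: measurable_funeM; exact/measurable_EFinP.
have -> : (\int[P]__ 1 = 1)%E by rewrite integral_cst//= mul1e probability_setT.
rewrite EFinD leeD2l//.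
rewrite ge0_integralZl//=; last first.
  exact/measurable_EFinP.
rewrite [leRHS]EFinM lee_wpmul2l//.
by move: hX; rewrite unlock => /ltW.
Qed.

End moments.

(** * Approximation of expectations and risks *)

Lemma indic_ge (R : realType) (t x : R) :
  \1_[set y | t <= y] x = (t <= x)%R%:R :> R.
Proof.
by rewrite indicE; congr (nat_of_bool _)%:R; apply/idP/idP => [/set_mem|/mem_set].
Qed.

Section expectation_gap.
Context d (T : measurableType d) (R : realType) (P : probability T R).
Variables (X : {RV P >-> R}) (V : R).
Hypothesis XV : (\int[P]_w (X w ^+ 2)%:E <= V%:E)%E.

Definition survival (t : R) : R := fine (P [set w | t <= X w]).

Lemma survivalE t : P [set w | t <= X w] = (survival t)%:E.
Proof.
rewrite /survival fineK//; apply: fin_num_measure.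
exact: measurable_superlevel.
Qed.

Let msurv t : measurable [set w | t <= X w].
Proof. exact: measurable_superlevel. Qed.

Lemma survival01 t : 0 <= survival t <= 1.
Proof. by rewrite -!lee_fin -survivalE measure_ge0 probability_le1. Qed.

Let integrable_sqr : P.-integrable setT (EFin \o (fun w => X w ^+ 2)).
Proof.
apply/integrableP; split.
  by apply/measurable_EFinP; exact: measurable_funX.
under eq_integral do rewrite /= ger0_norm ?sqr_ge0//.
exact: le_lt_trans XV (ltry _).
Qed.

Let integrable_cst (c : R) : P.-integrable setT (EFin \o cst c).
Proof. exact: finite_measure_integrable_cst. Qed.

Let integrable_affine_sqr (a c : R) :
  P.-integrable setT (EFin \o (fun w => a + c * X w ^+ 2)).
Proof.
have -> : EFin \o (fun w => a + c * X w ^+ 2) =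
    (fun w => (EFin \o cst a) w + c%:E * (EFin \o (fun w => X w ^+ 2)%R) w)%E.
  by apply/funext => w /=; rewrite EFinD EFinM.
by apply: integrableD => //; exact: integrableZl.
Qed.

Lemma integrable_lipschitz (f : R -> R) (L : R) : 0 <= L ->
  measurable_fun setT f -> (forall x y, `|f x - f y| <= L * `|x - y|) ->
  P.-integrable setT (EFin \o (fun w => f (X w))).
Proof.
move=> L0 mf fL.
apply: (le_integrable _ _ _ (integrable_affine_sqr (`|f 0| + L) L)) => //.
  by apply/measurable_EFinP; exact: measurableT_comp.
move=> w _ /=; rewrite lee_fin [leRHS]ger0_norm; last first.
  by rewrite !addr_ge0// mulr_ge0// sqr_ge0.
have := fL (X w) 0; rewrite subr0 => H.
have H2 : `|X w| <= 1 + X w ^+ 2.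
  by rewrite -real_normK ?num_real//; have := sqr_ge0 (`|X w| - 1); have := sqr_ge0 `|X w|; rewrite sqrrB1; lra.
have := ler_normD (f (X w) - f 0) (f 0); rewrite subrK.
by have := ler_wpM2l L0 H2; lra.
Qed.

Let integral_step (f : R -> R) (a h : R) (m : nat) :
  P.-integrable setT (EFin \o (fun w => step f a h m (X w))) /\
  \int[P]_w step f a h m (X w) =
    f a + \sum_(j < m) (f (a + j.+1%:R * h) - f (a + j%:R * h)) *
                       survival (a + j.+1%:R * h).
Proof.
elim: m => [|m [im IH]].
  have -> : (fun w => step f a h 0 (X w)) = cst (f a).
    by apply/funext => w; rewrite /step big_ord0 addr0.
  by split=> //; rewrite big_ord0 Rintegral_cst//= probability_setT mulr1 addr0.
set D := f (a + m.+1%:R * h) - f (a + m%:R * h); set t := a + m.+1%:R * h.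
have -> : (fun w => step f a h m.+1 (X w)) =
    (fun w => step f a h m (X w) + D * \1_[set w | t <= X w] w).
  apply/funext => w; rewrite /step big_ord_recr/= addrA; congr (_ + _ * _).
  by rewrite -(indic_ge t) !indicE.
have i1 : P.-integrable setT (EFin \o (\1_[set w | t <= X w] : T -> R)).
  by apply: integrable_indic => //; rewrite ltey_eq fin_num_measure.
have i2 : P.-integrable setT (EFin \o (fun w => D * \1_[set w | t <= X w] w)).
  have -> : EFin \o (fun w => D * \1_[set w | t <= X w] w) =
     (fun w => D%:E * (EFin \o (\1_[set w | t <= X w] : T -> R)%R) w)%E.
    by apply/funext => w /=; rewrite EFinM.
  exact: integrableZl.
split; first by have := integrableD measurableT im i2.
rewrite RintegralD// IH big_ord_recr/= addrA; congr (_ + _).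
rewrite RintegralZl//; congr (_ * _).
by rewrite /Rintegral integral_indic// setIT.
Qed.

(** Both averages of [f] are compared with those of its step function on [[- M, M]], each at the
    cost of one [h]. Truncation costs [V / (4 * M)] under [P]; the empirical truncation term is
    random and stays explicit. *)
Lemma empirical_gap (f : R -> R) (L h : R) (K n : nat) (x : 'I_n -> R) :
  0 <= L -> measurable_fun setT f ->
  (forall x y, `|f x - f y| <= L * `|x - y|) ->
  0 < h -> (0 < K)%N -> (0 < n)%N ->
  `|n%:R^-1 * (\sum_(i < n) f (x i)) - \int[P]_w f (X w)| <=
    L * (2 * h + V / (4 * (K%:R * h))
      + n%:R^-1 * \sum_(i < n) Num.max 0 (`|x i| - K%:R * h)
      + n%:R^-1 * (h * \sum_(j < K + K)
          `|\sum_(i < n) \1_[set y | - (K%:R * h) + j.+1%:R * h <= y] (x i)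
            - n%:R * survival (- (K%:R * h) + j.+1%:R * h)|)).
Proof.
move=> L0 mf fL h0 K0 n0; set M := K%:R * h.
have M0 : 0 < M by rewrite mulr_gt0// ltr0n.
have nR : 0 < n%:R :> R by rewrite ltr0n.
pose g := step f (- M) h (K + K).
have fg y : `|f y - g y| <= L * (h + Num.max 0 (`|y| - M)).
  apply: (le_trans (step_approx (- M) (K + K) y L0 h0 fL)).
  rewrite ler_wpM2l// -addrA lerD2l.
  have -> : - M + (K + K)%:R * h = M by rewrite /M natrD; ring.
  have [y0|y0] := lerP 0 y.
    rewrite (max_idPl _) ?add0r; last lra.
    by rewrite ger0_norm.
  by rewrite addrC (max_idPl _) ?add0r ?ltr0_norm ?[- M - y]addrC//; lra.
have [ig Eg] := integral_step f (- M) h (K + K).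
have iff := integrable_lipschitz L0 mf fL.
have i_fg : `|\int[P]_w f (X w) - \int[P]_w g (X w)| <= L * (h + V / (4 * M)).
  rewrite -RintegralB//; apply: (le_trans (le_normr_Rintegral _ _)) => //.
    by have := integrableB measurableT iff ig.
  apply: (@le_trans _ _ (\int[P]_w (L * h + L / (4 * M) * X w ^+ 2))).
    apply: le_Rintegral => //.
      by apply: integrable_norm; have := integrableB measurableT iff ig.
    move=> w _; apply: (le_trans (fg _)); rewrite mulrDr lerD2l -mulrA ler_wpM2l//.
    apply: (le_trans (pos_part_le _ M0)).
    by rewrite real_normK ?num_real// mulrC.
  rewrite RintegralD//; last 2 first.
  - exact: (integrable_cst (L * h)).
  - by have := integrable_affine_sqr 0 (L / (4 * M)); under eq_fun do rewrite add0r.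
  rewrite Rintegral_cst//= probability_setT mulr1 RintegralZl//.
  rewrite mulrDr lerD2l -mulrA ler_wpM2l// mulrC ler_wpM2r//.
    by rewrite invr_ge0 mulr_ge0// ltW.
  rewrite -lee_fin /Rintegral fineK//.
  exact: (integrable_fin_num _ integrable_sqr).
have e_fg : `|n%:R^-1 * (\sum_(i < n) f (x i)) - n%:R^-1 * (\sum_(i < n) g (x i))|
    <= L * (h + n%:R^-1 * \sum_(i < n) Num.max 0 (`|x i| - M)).
  rewrite -mulrBr -sumrB normrM ger0_norm ?invr_ge0 ?ler0n//.
  apply: (@le_trans _ _ (n%:R^-1 * \sum_(i < n) L * (h + Num.max 0 (`|x i| - M)))).
    rewrite ler_wpM2l ?invr_ge0 ?ler0n//; apply: (le_trans (ler_norm_sum _ _ _)).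
    by apply: ler_sum => i _; exact: fg.
  rewrite -mulr_sumr big_split/= sumr_const card_ord -[_ *+ _]mulr_natr.
  by rewrite le_eqVlt; apply/orP; left; apply/eqP; field; rewrite gt_eqF.
have e_g : `|n%:R^-1 * (\sum_(i < n) g (x i)) - \int[P]_w g (X w)| <=
    L * (n%:R^-1 * (h * \sum_(j < K + K)
          `|\sum_(i < n) \1_[set y | - M + j.+1%:R * h <= y] (x i)
            - n%:R * survival (- M + j.+1%:R * h)|)).
  (* The constant [f (- M)] cancels, both laws having mass 1. What remains is weighted by increments
     of [f] over one cell, at most [L * h]. *)
  have -> : n%:R^-1 * (\sum_(i < n) g (x i)) - \int[P]_w g (X w) =
      n%:R^-1 * \sum_(j < K + K) (f (- M + j.+1%:R * h) - f (- M + j%:R * h)) *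
        (\sum_(i < n) \1_[set y | - M + j.+1%:R * h <= y] (x i)
            - n%:R * survival (- M + j.+1%:R * h)).
    rewrite Eg /g /step big_split/= sumr_const card_ord exchange_big/=.
    under eq_bigr => j _.
      rewrite -mulr_sumr; under eq_bigr do rewrite -indic_ge.
      over.
    under [in RHS]eq_bigr do rewrite mulrBr.
    rewrite sumrB -[_ *+ _]mulr_natr.
    under [X in _ = _ * (_ - X)]eq_bigr do rewrite mulrCA.
    by rewrite -mulr_sumr; field; rewrite gt_eqF.
  rewrite normrM ger0_norm ?invr_ge0 ?ler0n// mulrCA.
  rewrite ler_wpM2l ?invr_ge0 ?ler0n//; apply: (le_trans (ler_norm_sum _ _ _)).
  rewrite mulrA mulr_sumr; apply: ler_sum => j _; rewrite normrM ler_wpM2r//.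
  apply: (le_trans (fL _ _)); rewrite ler_wpM2l//.
  have -> : - M + j.+1%:R * h - (- M + j%:R * h) = h by rewrite -natr1; ring.
  by rewrite ger0_norm// ltW.
rewrite distrC in i_fg; rewrite -/M.
have -> : 2 * h = h + h by ring.
apply: (le_trans (ler_distD (n%:R^-1 * \sum_(i < n) g (x i)) _ _)).
apply: (le_trans (lerD e_fg (le_trans (ler_distD (\int[P]_w g (X w)) _ _)
  (lerD e_g i_fg)))).
by rewrite -!mulrDr ler_wpM2l// le_eqVlt; apply/orP; left; apply/eqP; ring.
Qed.

End expectation_gap.

(** A uniform gap passes to the infima; finiteness of the one for [G] forces that for [F]. *)
Lemma ereal_inf_close (R : realType) (F G : R -> R) (B : R) :
  (forall x, `|F x - G x| <= B) ->
  ereal_inf (range (EFin \o G)) \is a fin_num ->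
  (`|ereal_inf (range (EFin \o F)) - ereal_inf (range (EFin \o G))| <= B%:E)%E.
Proof.
move=> FG; move gE : (ereal_inf (range (EFin \o G))) => g.
case: g gE => // g gE _.
have lo : ((g - B)%:E <= ereal_inf (range (EFin \o F)))%E.
  apply: le_ereal_inf_tmp => _ [x _ <-] /=; rewrite lee_fin.
  have : (g%:E <= (G x)%:E)%E by rewrite -gE; apply: ereal_inf_lbound; exists x.
  by rewrite lee_fin; have := FG x; rewrite ler_norml => /andP[]; lra.
have hi : (ereal_inf (range (EFin \o F)) <= (g + B)%:E)%E.
  rewrite EFinD -leeBlDr// -gE.
  apply: le_ereal_inf_tmp => _ [x _ <-]; rewrite leeBlDr//.
  apply: (@le_trans _ _ (F x)%:E); first by apply: ereal_inf_lbound; exists x.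
  by rewrite lee_fin; have := FG x; rewrite ler_norml => /andP[]; lra.
move: lo hi; case: (ereal_inf _) => [r||]//=.
by rewrite !lee_fin => lo hi; rewrite ler_norml; apply/andP; split; lra.
Qed.

(** * Measurability of the empirical risk *)

Section empirical_oce.
Context (R : realType) (phi : R -> R) (L : R) (n : nat).
Hypotheses (L0 : 0 <= L) (phiL : forall x y, `|phi x - phi y| <= L * `|x - y|)
  (n0 : (0 < n)%N).

Let F (x : 'I_n -> R) (xi : R) : R := xi + n%:R^-1 * \sum_(i < n) phi (x i - xi).

Let F_lip x xi zeta : F x zeta <= F x xi + (1 + L) * `|zeta - xi|.
Proof.
have nR : 0 < n%:R :> R by rewrite ltr0n.
rewrite /F mulrDl mul1r addrACA; apply: lerD; first by have := ler_norm (zeta - xi); lra.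
rewrite -[X in _ + X](mulKf (lt0r_neq0 nR)) -mulrDr ler_wpM2l ?invr_ge0 ?ler0n//.
rewrite mulr_natl -[X in _ *+ X]card_ord -sumr_const -big_split/=.
apply: ler_sum => i _; rewrite -lerBlDl; apply: (le_trans (ler_norm _)).
apply: (le_trans (phiL _ _)); rewrite ler_wpM2l//.
have -> : x i - zeta - (x i - xi) = - (zeta - xi) by ring.
by rewrite normrN.
Qed.

(** Codes of no rational are sent to 0, which only repeats a value in the infimum. *)
Let rat_enum (k : nat) : R := ratr (odflt 0%R (unpickle k : option rat)).

(* The infimum over the reals is an infimum over the rationals, hence countable. *)
Let oce_empE x : oce_emp phi x = einfs (fun k => (F x (rat_enum k))%:E) 0%N.
Proof.
apply/eqP; rewrite eq_le; apply/andP; split.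
  apply: le_ereal_inf_tmp => _ [k _ <-]; apply: ereal_inf_lbound.
  by exists (rat_enum k).
apply: le_ereal_inf_tmp => _ [xi _ <-]; rewrite -/(F x xi).
apply/lee_addgt0Pr => e e0.
have L1 : 0 < 1 + L by rewrite ltr_pwDl.
have xie : xi < xi + e / (1 + L) by rewrite ltrDl divr_gt0.
have [q] := rat_in_itvoo xie.
rewrite in_itv/= => /andP[q1 q2].
apply: (@le_trans _ _ (F x (ratr q))%:E).
  apply: ereal_inf_lbound; exists (pickle q) => //.
  by rewrite /rat_enum pickleK.
rewrite -EFinD lee_fin; apply: (le_trans (F_lip _ xi _)); rewrite lerD2l.
rewrite ger0_norm; last by rewrite subr_ge0 ltW.
by rewrite mulrC -ler_pdivlMr// lerBlDl ltW.
Qed.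

Lemma measurable_oce_emp d (S : measurableType d) (Q : probability S R)
    (Xs : 'I_n -> {RV Q >-> R}) : measurable_fun setT phi ->
  measurable_fun setT (fun w => oce_emp phi (fun i => Xs i w)).
Proof.
move=> mphi.
have -> : (fun w => oce_emp phi (fun i => Xs i w)) =
    (fun w => einfs ((fun k w => (F (fun i => Xs i w) (rat_enum k))%:E)^~ w) 0%N).
  by apply/funext => w; rewrite oce_empE.
apply: measurable_fun_einfs => k; apply/measurable_EFinP.
apply: measurable_funD => //; apply: measurable_funM => //.
apply: measurable_sum => i; apply: measurableT_comp => //.
exact: measurable_funB.
Qed.

End empirical_oce.

(** * Concentration of the empirical risk *)

(** Bound on the total grid weight: [1 + (b - 1)^-1] for each side of the origin and 1 for the grid
    point 0. *)
Definition grid_const (R : realType) (b : R) : R := 3 + 2 / (b - 1).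

(* The grid points are [(j + 1 - K) * rho / m] for [j < K + K]. *)
Definition grid_weight (R : realType) (b : R) (m K j : nat) : R :=
  (m%:R * profile b (`|j.+1%:R - K%:R| / m%:R))^-1.

Lemma grid_weight_gt0 (R : realType) (b : R) (m K j : nat) : (0 < m)%N ->
  0 < grid_weight b m K j.
Proof. by move=> m0; rewrite invr_gt0 mulr_gt0 ?ltr0n ?profile_gt0. Qed.

Lemma sum_grid_weight (R : realType) (b : R) (m K : nat) :
  1 < b -> (0 < m)%N -> (0 < K)%N ->
  \sum_(j < K + K) grid_weight b m K j <= grid_const b.
Proof.
move=> b1 m0 K0; have b10 : 0 < b - 1 by rewrite subr_gt0.
have positive : \sum_(j < K) grid_weight b m K (K + j) <= 1 + (b - 1)^-1.
  apply: le_trans (sum_profile K b1 m0); apply: ler_sum => j _.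
  by rewrite /grid_weight -addnS natrD addrAC subrr add0r normr_nat.
(* After reversal, index [j] is the point [j] steps left of the origin, so this half contains 0. *)
have negative :
    \sum_(j < K) grid_weight b m K (rev_ord j) <= 1 + (1 + (b - 1)^-1).
  apply: (@le_trans _ _ (\sum_(j < K) (m%:R * profile b (j%:R / m%:R))^-1)).
    apply: ler_sum => j _; rewrite /grid_weight/= subnSK// natrB; last exact: ltnW.
    by rewrite [_ - _ - _]addrAC subrr add0r normrN normr_nat.
  case: K K0 {positive} => // K _; rewrite big_ord_recl/=.
  apply: lerD; last exact: sum_profile.
  rewrite invf_le1 ?mulr_gt0 ?ltr0n ?profile_gt0// -[leLHS]mulr1.
  by rewrite ler_pM ?ler1n ?profile_ge1.
rewrite big_split_ord (reindex_inj rev_ord_inj).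
apply: (le_trans (lerD negative positive)); rewrite /grid_const.
by rewrite le_eqVlt; apply/orP; left; apply/eqP; ring.
Qed.

Lemma exists_natr_gt (R : realType) (x : R) : exists2 k : nat, (0 < k)%N & x < k%:R.
Proof.
exists (Num.bound `|x|).+1 => //; apply: (le_lt_trans (ler_norm x)).
by apply: (lt_le_trans (archi_boundP (normr_ge0 x))); rewrite ler_nat.
Qed.

Lemma same_distribution_integral d d' (T : measurableType d)
    (S : measurableType d') (R : realType) (P : probability T R)
    (Q : probability S R) (X : {RV P >-> R}) (Y : {RV Q >-> R})
    (f : R -> \bar R) :
  same_distribution Y X -> measurable_fun setT f -> (forall x, 0 <= f x)%E ->
  (\int[Q]_w f (Y w) = \int[P]_w f (X w))%E.
Proof.
move=> YX mf f0.
have -> := esym (ge0_integral_distribution Y mf f0).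
have -> := esym (ge0_integral_distribution X mf f0).
by apply: eq_measure_integral => A mA _; exact: YX.
Qed.

Section concentration.
Context d (T : measurableType d) (R : realType) (P : probability T R).
Variables (X : {RV P >-> R}) (b g top : R).
Hypotheses (b1 : 1 < b) (g0 : 0 < g)
  (hX : ('E_P[fun w => expR (g * `|X w| `^ b)] < top%:E)%E).
Context d' (S : measurableType d') (Q : probability S R) (n : nat).
Variable Xs : 'I_n -> {RV Q >-> R}.
Hypotheses (n0 : (0 < n)%N) (Xs_indep : mutually_independent Xs)
  (Xs_distr : forall i, same_distribution (Xs i) X).

Let V : R := 1 + 2 / g ^+ 2 * top.

Lemma survival_tail t : Num.min (survival X t) (1 - survival X t) <=
  top * expR (- (g * `|t| `^ b)).
Proof.
have mge c : measurable [set w | c <= X w] by exact: measurable_superlevel.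
have mabs c : measurable [set w | c <= `|X w|].
  by apply: measurable_superlevel; exact: measurableT_comp.
have tb := tail_prob b1 g0 hX (normr_ge0 t).
rewrite ge_min; apply/orP; have [t0|t0] := lerP 0 t; [left|right].
  rewrite -lee_fin -survivalE; apply: le_trans tb.
  rewrite le_measure ?inE// => w /= tX.
  by rewrite ger0_norm//; apply: (le_trans tX); exact: ler_norm.
rewrite -lee_fin EFinB -survivalE -probability_setC//; apply: le_trans tb.
rewrite le_measure ?inE//; first exact: measurableC.
move=> w /= /negP; rewrite -ltNge => Xt.
by rewrite !ltr0_norm ?(lt_trans Xt)// lerN2 ltW.
Qed.

Let truncation (M : R) (w : S) : R :=
  n%:R^-1 * \sum_(i < n) Num.max 0 (`|Xs i w| - M).

Let deviation (h : R) (K : nat) (w : S) : R := h * \sum_(j < K + K)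
  `|\sum_(i < n) \1_[set y | - (K%:R * h) + j.+1%:R * h <= y] (Xs i w)
    - n%:R * survival X (- (K%:R * h) + j.+1%:R * h)|.

Let measurable_truncation (M : R) : measurable_fun setT (truncation M).
Proof.
apply: measurable_funM => //; apply: measurable_sum => i.
apply: (measurable_maxr (f := cst 0)) => //.
by apply: measurable_funB => //; exact: measurableT_comp.
Qed.

Let measurable_deviation (h : R) (K : nat) : measurable_fun setT (deviation h K).
Proof.
apply: measurable_funM => //; apply: measurable_sum => j.
apply: measurableT_comp => //; apply: measurable_funB => //.
apply: measurable_count; exact: (measurable_superlevel (f := id)).
Qed.

(** Markov's inequality gives no exponential decay in [n], but [M] is free and can be taken large
    enough to beat any target probability. *)
Lemma truncation_tail (M eta : R) : 0 < M -> 0 < eta ->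
  (Q [set w | (eta <= truncation M w)%R] <= (V / (4 * M) / eta)%:E)%E.
Proof.
move=> M0 eta0; have nR : 0 < n%:R :> R by rewrite ltr0n.
apply: (le_trans (markov_ge0 Q (@measurable_truncation M) _ eta0)).
  move=> w; rewrite mulr_ge0 ?invr_ge0 ?ler0n// sumr_ge0// => i _.
  by rewrite le_max lexx.
rewrite [X in (_ <= X%:E)%E]mulrC [leRHS]EFinM lee_wpmul2l ?lee_fin ?invr_ge0 ?(ltW eta0)//.
have c0 : 0 <= (n%:R * (4 * M))^-1 by rewrite invr_ge0 !mulr_ge0 ?ler0n ?(ltW M0).
apply: (@le_trans _ _ (\int[Q]_w
    (((n%:R * (4 * M))^-1)%:E * \sum_(i < n) (Xs i w ^+ 2)%:E))%E).
  apply: ge0_le_integral => //.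
  - move=> w _; rewrite lee_fin mulr_ge0 ?invr_ge0 ?ler0n// sumr_ge0// => i _.
    by rewrite le_max lexx.
  - by apply/measurable_EFinP; exact: measurable_truncation.
  - apply: measurable_funeM; apply: emeasurable_sum => i.
    by apply/measurable_EFinP; exact: measurable_funX.
  - move=> w _; rewrite sumEFin -EFinM lee_fin invfM -mulrA.
    rewrite ler_wpM2l ?invr_ge0 ?ler0n// mulr_sumr; apply: ler_sum => i _.
    by rewrite mulrC -[X in X / _]real_normK ?num_real// pos_part_le.
have msq i : measurable_fun setT (fun w => (Xs i w ^+ 2)%:E).
  by apply/measurable_EFinP; exact: measurable_funX.
rewrite ge0_integralZl//=; last 2 first.
- exact: emeasurable_sum.
- by move=> w _; rewrite sume_ge0// => i _; rewrite lee_fin sqr_ge0.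
rewrite ge0_integral_sum//=; last first.
  by move=> i w _; rewrite lee_fin sqr_ge0.
apply: (@le_trans _ _ (((n%:R * (4 * M))^-1)%:E * \sum_(i < n) V%:E)%E).
  rewrite lee_wpmul2l//; apply: lee_sum => i _.
  rewrite (same_distribution_integral (f := fun y => (y ^+ 2)%:E) (Xs_distr i)).
  - exact: second_moment b1 g0 hX.
  - by apply/measurable_EFinP; exact: exprn_measurable.
  - by move=> y; rewrite lee_fin sqr_ge0.
rewrite sumEFin -EFinM lee_fin sumr_const card_ord -[_ *+ _]mulr_natr.
by rewrite le_eqVlt; apply/orP; left; apply/eqP; field; rewrite !gt_eqF.
Qed.

Variables (phi : R -> R) (L : R).
Hypotheses (L0 : 0 < L) (mphi : measurable_fun setT phi)
  (phiL : forall x y, `|phi x - phi y| <= L * `|x - y|)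
  (oce_fin : oce P phi X \is a fin_num).

(** The translates of [phi] share the Lipschitz constant [L], so [empirical_gap] bounds the two
    objectives uniformly in [xi]. *)
Lemma oce_gap (h : R) (K : nat) (w : S) : 0 < h -> (0 < K)%N ->
  (`|oce_emp phi (fun i => Xs i w) - oce P phi X| <=
   (L * (2 * h + V / (4 * (K%:R * h)) + truncation (K%:R * h) w
         + n%:R^-1 * deviation h K w))%:E)%E.
Proof.
move=> h0 K0.
pose G xi := xi + \int[P]_v phi (X v - xi).
have XV := second_moment b1 g0 hX.
have mphi' xi : measurable_fun setT (fun y : R => phi (y - xi)).
  by apply: measurableT_comp => //; exact: measurable_funB.
have phiL' xi y z : `|phi (y - xi) - phi (z - xi)| <= L * `|y - z|.
  apply: (le_trans (phiL _ _)).
  by have -> : y - xi - (z - xi) = y - z by ring.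
have oceE : oce P phi X = ereal_inf (range (EFin \o G)).
  rewrite /oce.
  suff -> : (fun xi : R => xi%:E + 'E_P[fun w => phi (X w - xi)%R])%E = EFin \o G by [].
  apply/funext => xi /=.
  rewrite EFinD; congr (_ + _)%E; rewrite unlock /Rintegral fineK//.
  apply: integrable_fin_num => //.
  exact: (integrable_lipschitz XV (ltW L0) (mphi' xi) (phiL' xi)).
move: oce_fin; rewrite oceE => Gfin.
apply: (ereal_inf_close _ Gfin) => xi.
have -> : xi + n%:R^-1 * (\sum_(i < n) phi (Xs i w - xi)) - G xi =
  n%:R^-1 * (\sum_(i < n) phi (Xs i w - xi)) - \int[P]_v phi (X v - xi).
  by rewrite /G; ring.
exact: (empirical_gap XV (fun i => Xs i w) (ltW L0) (mphi' xi) (phiL' xi)).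
Qed.

Lemma deviation_tail (rho lam psi y : R) (m K : nat) :
  0 < rho -> 0 < lam -> (0 < m)%N -> (0 < K)%N ->
  (forall u q s, 0 <= u -> 0 <= q -> q <= 1 ->
     q <= top * expR (- (g * u `^ b)) -> 0 <= s ->
     s <= grid_const b * lam * rho * profile b (u / rho) ->
     Num.min (q * (s ^+ 2 * expR s)) s <= psi) ->
  (Q [set w | (y <= deviation (rho / m%:R) K w)%R]
    <= (2 * expR (n%:R * psi - lam * y))%:E)%E.
Proof.
move=> rho0 lam0 m0 K0 psi_ge; set h := rho / m%:R.
have mR : 0 < m%:R :> R by rewrite ltr0n.
have h0 : 0 < h by rewrite divr_gt0.
(* Normalizing the weights to mass 1 multiplies the exponents by [W], at most [grid_const b]. *)
pose W : R := \sum_(j < K + K) grid_weight b m K j.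
have W0 : 0 < W.
  rewrite {}/W; case: K K0 => // K' _; rewrite big_ord_recl.
  rewrite ltr_pwDl ?grid_weight_gt0// sumr_ge0// => j _.
  by rewrite ltW// grid_weight_gt0.
have WC : W <= grid_const b by exact: sum_grid_weight.
pose t (j : 'I_(K + K)) : R := - (K%:R * h) + j.+1%:R * h.
apply: (@weighted_count_tail _ _ _ Q n Xs Xs_indep (K + K) t
  (fun j => survival X (t j)) (fun j => grid_weight b m K j / W)) => //.
- move=> j i; rewrite -survivalE.
  have /(_ [set x | t j <= x]) := Xs_distr i.
  rewrite /distribution /pushforward => ->//.
  by rewrite -set_itvcy.
- by move=> j; exact: survival01.
- by move=> j; rewrite divr_gt0// grid_weight_gt0.
- by rewrite -mulr_suml divff// gt_eqF.
- move=> j; have := survival01 X (t j) => /andP[p0 p1].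
  have v0 := grid_weight_gt0 b K j m0.
  apply: (psi_ge `|t j|) => //.
  + by rewrite le_min p0 subr_ge0.
  + by rewrite ge_min p1.
  + exact: survival_tail.
  + exact: divr_ge0 (mulr_ge0 (ltW lam0) (ltW h0)) (divr_ge0 (ltW v0) (ltW W0)).
  have -> : `|t j| / rho = `|j.+1%:R - K%:R| / m%:R.
    have -> : t j = (j.+1%:R - K%:R) * h by rewrite /t; ring.
    rewrite normrM (gtr0_norm h0) /h; field.
    by rewrite !gt_eqF.
  (* The [m] in the weight cancels the one in [h = rho / m]: the exponent bound is independent of
     the mesh and of [K]. *)
  have -> : lam * h / (grid_weight b m K j / W) =
      W * (lam * rho * profile b (`|j.+1%:R - K%:R| / m%:R)).
    rewrite /grid_weight /h; field.
    by rewrite !gt_eqF// profile_gt0.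
  rewrite -(mulrA _ lam rho) -(mulrA (grid_const b)) ler_wpM2r//.
  by rewrite !mulr_ge0 ?(ltW lam0) ?(ltW rho0) ?(ltW (profile_gt0 _ _)).
Qed.

Lemma oce_concentration (rho lam psi eps : R) :
  0 < rho -> 0 < lam -> 0 < eps ->
  (forall u q s, 0 <= u -> 0 <= q -> q <= 1 ->
     q <= top * expR (- (g * u `^ b)) -> 0 <= s ->
     s <= grid_const b * lam * rho * profile b (u / rho) ->
     Num.min (q * (s ^+ 2 * expR s)) s <= psi) ->
  (Q [set w | eps%:E < `|oce_emp phi (fun i => Xs i w) - oce P phi X|]
    <= (3 * expR (n%:R * (psi - lam * (eps / L) / 2)))%:E)%E.
Proof.
move=> rho0 lam0 eps0 psi_ge; set x := eps / L.
have nR : 0 < n%:R :> R by rewrite ltr0n.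
have x0 : 0 < x by rewrite divr_gt0.
set E := expR _; have E0 : 0 < E := expR_gt0 _.
have [m m0 mx] := exists_natr_gt (8 * rho / x).
have mR : 0 < m%:R :> R by rewrite ltr0n.
set h := rho / m%:R; have h0 : 0 < h by rewrite divr_gt0.
have hx : h <= x / 8.
  move: mx; rewrite ltr_pdivrMr// => mx.
  by rewrite /h ler_pdivrMr//; lra.
(* [K] is chosen after [m]: the truncation level [K * h] must make the deterministic error at most
   [x / 8] and the Markov bound at most [E]. *)
have [K K0 KV] := exists_natr_gt (V / (4 * h) / Num.min (x / 8) (h * E)).
have KR : 0 < K%:R :> R by rewrite ltr0n.
have VK : V / (4 * (K%:R * h)) <= Num.min (x / 8) (h * E).
  move: KV; rewrite ltr_pdivrMr; last by rewrite lt_min divr_gt0// mulr_gt0.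
  have -> : V / (4 * (K%:R * h)) = V / (4 * h) / K%:R by field; rewrite !gt_eqF.
  by move=> KV; rewrite ler_pdivrMr// [_ * K%:R]mulrC; exact: ltW.
move: VK; rewrite le_min => /andP[VK1 VK2].
set A := [set w | _]; set A1 := [set w | h <= truncation (K%:R * h) w].
set A2 := [set w | n%:R * (x / 2) <= deviation h K w].
have mA1 : measurable A1 by exact: measurable_superlevel.
have mA2 : measurable A2 by exact: measurable_superlevel.
have mA : measurable A.
  rewrite -[X in measurable X]setTI; apply: emeasurable_fun_o_infty => //.
  apply: measurableT_comp; first exact: abse_measurable.
  apply: emeasurable_funB => //.
  exact: (measurable_oce_emp (ltW L0) phiL n0 Xs mphi).
(* Error budget in units of [L]: [x / 4] for the mesh, [x / 8] for each truncation term and [x / 2]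
   for the deviation, [x] in all. *)
have AA : A `<=` A1 `|` A2.
  move=> w Aw; have [|t1] := leP h (truncation (K%:R * h) w); first by left.
  right; rewrite /A2/= leNgt; apply/negP => d1.
  move: Aw; rewrite /A/= ltNge => /negP; apply.
  apply: (le_trans (oce_gap w h0 K0)); rewrite lee_fin.
  have -> : eps = L * x by rewrite /x mulrC divfK// gt_eqF.
  rewrite ler_pM2l//.
  have : n%:R^-1 * deviation h K w <= x / 2 by rewrite ler_pdivrMl// ltW.
  lra.
apply: (@le_trans _ _ (Q (A1 `|` A2))); first by rewrite le_measure ?inE//; exact: measurableU.
apply: (le_trans (measureU2 _ _ _)) => //.
have -> : (3 * E)%:E = (E%:E + (2 * E)%:E)%E by rewrite -EFinD; congr (_%:E); ring.
apply: leeD.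
  apply: (le_trans (truncation_tail _ h0)); first by rewrite mulr_gt0.
  by rewrite lee_fin ler_pdivrMr// [E * h]mulrC.
apply: (le_trans (deviation_tail (n%:R * (x / 2)) rho0 lam0 m0 K0 psi_ge)).
rewrite lee_fin ler_pM2l// /E ler_expR.
by rewrite le_eqVlt; apply/orP; left; apply/eqP; ring.
Qed.

End concentration.

(** * Choice of the constants and the two regimes *)

Theorem corollary28 (R : realType) (beta gamma top : R)
    (hbeta : 1 < beta) (hgamma : 0 < gamma) (htop : 0 < top) :
  exists c1 c2 c3 : R,
    [/\ 0 < c1, 0 < c2 & 0 < c3] /\
    forall (d : measure_display) (T : measurableType d) (P : probability T R)
      (X : {RV P >-> R})
      (hX : ('E_P[fun w => expR (gamma * `|X w| `^ beta)] < top%:E)%E)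
      (L : R) (hL : 0 < L) (phi : R -> R)
      (phi_nd : {homo phi : x y / x <= y})
      (phi_convex : convex_function [set: R^o] phi)
      (phi_lip : L.-lipschitz phi)
      (oce_fin : oce P phi X \is a fin_num)
      (n : nat) (hn : (1 <= n)%N)
      (d' : measure_display) (S : measurableType d') (Q : probability S R)
      (Xs : 'I_n -> {RV Q >-> R})
      (Xs_indep : mutually_independent Xs)
      (Xs_distr : forall i, same_distribution (Xs i) X)
      (eps : R) (heps : 0 < eps),
    (Q [set w | eps%:E < `|oce_emp phi (fun i => Xs i w) - oce P phi X|]
     <= (c1 * (expR (- c2 * n%:R * (eps / L) ^+ 2) * (eps <= L)%R%:R
               + expR (- c3 * n%:R * (eps / L) `^ beta) * (L < eps)%R%:R))%:E)%E.
Proof.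
have b10 : 0 < beta - 1 by rewrite subr_gt0.
have b0 : 0 < beta by apply: lt_trans hbeta.
set C0 := grid_const beta.
have C00 : 0 < C0 by rewrite ltr_pwDl// mulr_ge0 ?invr_ge0 ?ltW.
(* Solves [2 * C0 * rho0 = gamma * rho0 ^ beta], the condition of [exponent_small]. *)
pose rho0 := (2 * C0 / gamma) `^ (beta - 1)^-1.
have rho00 : 0 < rho0 by rewrite powR_gt0// divr_gt0// mulr_gt0.
have powS (r : R) : 0 < r -> r `^ beta = r * r `^ (beta - 1).
  move=> r0; rewrite -{2}(powRr1 (ltW r0)) -powRD ?(gt_eqF r0) ?implybT//.
  by rewrite addrC subrK.
have rho0E : 2 * (C0 * rho0) <= gamma * rho0 `^ beta.
  rewrite powS// -[rho0 `^ (beta - 1)]powRrM mulVf ?gt_eqF// powRr1; last first.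
    by rewrite divr_ge0 ?mulr_ge0 ?(ltW C00) ?(ltW hgamma).
  by rewrite le_eqVlt; apply/orP; left; apply/eqP; field; rewrite gt_eqF.
pose C := 2 * (expR (2 * (C0 * rho0)) + top).
have Cgt0 : 0 < C by rewrite mulr_gt0// addr_gt0// expR_gt0.
pose c4 := gamma / (2 * C0) * (8 * C0)^-1 `^ (beta - 1).
have c40 : 0 < c4 by rewrite mulr_gt0 ?powR_gt0 ?invr_gt0 ?divr_gt0 ?mulr_gt0.
(* Beyond [D] one has [16 * top <= c4 * x ^ beta], so the additive [2 * top] of [exponent_large] is
   absorbed. *)
pose D := Num.max 1 (16 * top / c4).
have D1 : 1 <= D by rewrite le_max lexx.
have D0 : 0 < D by apply: lt_le_trans D1.
(* With [lam = kappa * x], the first entry gives [lam <= 1] up to [x = D]; the second leaves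
   [kappa * x ^+ 2 / 4] of the gain [lam * x / 2]. *)
pose kappa := Num.min D^-1 (4 * C)^-1.
have kappa0 : 0 < kappa by rewrite lt_min !invr_gt0 D0 mulr_gt0.
exists 3, (kappa / 4), (Num.min (c4 / 4) (kappa / (4 * D `^ beta))).
split.
  split; rewrite ?divr_gt0// lt_min !divr_gt0// mulr_gt0// powR_gt0//.
move=> d T P X hX L hL phi phi_nd _ phi_lip oce_fin n hn d' S Q Xs Xs_indep
  Xs_distr eps heps.
have phiL x y : `|phi x - phi y| <= L * `|x - y| by exact: (phi_lip (x, y)).
have mphi : measurable_fun setT phi by exact: nondecreasing_measurable.
set x := eps / L; have x0 : 0 < x by rewrite divr_gt0.
have nR : 0 < n%:R :> R by rewrite ltr0n.
set A := Q _.
have small : x <= D -> (A <= (3 * expR (- (kappa / 4) * n%:R * x ^+ 2))%:E)%E.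
  move=> xD; have kx0 : 0 < kappa * x by rewrite mulr_gt0.
  have kx1 : kappa * x <= 1.
    rewrite -ler_pdivlMr// mul1r ge_min; apply/orP; left.
    by rewrite lef_pV2// posrE.
  have kC : kappa * C <= 1 / 4.
    rewrite -ler_pdivlMr// ge_min; apply/orP; right.
    by rewrite invfM mul1r.
  apply: le_trans (oce_concentration hbeta hgamma hX hn Xs_indep Xs_distr
    hL mphi phiL oce_fin rho00 kx0 heps (psi := (kappa * x) ^+ 2 * C) _) _.
    move=> u q s u0 q0 q1 qt s0 sle.
    exact: (exponent_small (ltW b0) C00 kx0 rho00 u0 q0 q1 qt s0 kx1 rho0E sle).
  rewrite lee_fin ler_pM2l// ler_expR -/x.
  have -> : - (kappa / 4) * n%:R * x ^+ 2 = n%:R * (- (kappa / 4 * x ^+ 2)) by ring.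
  rewrite ler_pM2l//.
  have x20 : 0 <= kappa * x ^+ 2 by rewrite mulr_ge0 ?sqr_ge0 ?ltW.
  by have := ler_wpM2l x20 kC; rewrite !expr2; lra.
have large : D < x -> (A <= (3 * expR (- (c4 / 4) * n%:R * x `^ beta))%:E)%E.
  (* [lam] is the largest value with [2 * C0 * lam * rho <= gamma * rho ^ beta], and this [rho]
     makes [C0 * lam * rho] equal to [lam * x / 8]. With [2 * top <= lam * x / 8], half of the gain
     [lam * x / 2] survives. *)
  move=> Dx; pose rho := x / (8 * C0); pose lam := gamma * rho `^ (beta - 1) / (2 * C0).
  have rhop : 0 < rho by rewrite divr_gt0// mulr_gt0.
  have lamp : 0 < lam by rewrite divr_gt0 ?mulr_gt0// powR_gt0.
  have lamx : lam * x = c4 * x `^ beta.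
    rewrite powS// /lam /rho powRM ?(ltW x0)//; last first.
      by rewrite invr_ge0 mulr_ge0// ltW.
    rewrite /c4; field; by rewrite gt_eqF.
  have top_le : 16 * top <= lam * x.
    rewrite lamx -ler_pdivrMl// [leLHS]mulrC.
    apply: (@le_trans _ _ D); first by rewrite le_max lexx orbT.
    apply: (le_trans (ltW Dx)); rewrite -{1}(powRr1 (ltW x0)).
    by apply: ler_powR; [exact: le_trans D1 (ltW Dx)|exact: ltW].
  have h2 : 2 * (C0 * lam * rho) <= gamma * rho `^ beta.
    rewrite (powS rho)// /lam le_eqVlt; apply/orP; left; apply/eqP; field.
    by rewrite gt_eqF.
  apply: le_trans (oce_concentration hbeta hgamma hX hn Xs_indep Xs_distr
    hL mphi phiL oce_fin rhop lamp heps (psi := C0 * lam * rho + 2 * top) _) _.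
    move=> u q s u0 q0 q1 qt s0 sle.
    exact: (exponent_large (ltW b0) C00 lamp rhop u0 q0 qt s0 h2 sle).
  rewrite lee_fin ler_pM2l// ler_expR -/x.
  have -> : C0 * lam * rho = lam * x / 8 by rewrite /rho; field; rewrite gt_eqF.
  have -> : - (c4 / 4) * n%:R * x `^ beta = n%:R * (- (lam * x / 4)).
    by rewrite lamx; ring.
  by rewrite ler_pM2l//; lra.
have [eL|Le] := leP eps L.
  have x1 : x <= 1 by rewrite ler_pdivrMr// mul1r.
  apply: (le_trans (small (le_trans x1 D1))).
  by rewrite mulr1 mulr0 addr0.
have x1 : 1 <= x by rewrite ler_pdivlMr// mul1r ltW.
(* The regimes meet at [D] and not at 1: for [1 <= x <= D] the Gaussian bound is weakened to a power
   [beta], using [x ^ beta <= D ^ beta] and [1 <= x ^+ 2]. This explains the second entry of the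
   third constant. *)
rewrite mulr0 mulr1 add0r; have [xD|Dx] := leP x D.
  apply: (le_trans (small xD)); rewrite lee_fin ler_pM2l// ler_expR.
  set c3 := Num.min _ _; have c30 : 0 < c3.
    by rewrite lt_min !divr_gt0// mulr_gt0// powR_gt0.
  suff H : c3 * x `^ beta <= kappa / 4 * x ^+ 2.
    by have := ler_wpM2l (ltW nR) H; lra.
  apply: (@le_trans _ _ (kappa / (4 * D `^ beta) * D `^ beta)).
    apply: ler_pM; rewrite ?powR_ge0//.
    - exact: ltW.
    - by rewrite ge_min lexx orbT.
    - by apply: (ge0_ler_powR (ltW b0)); rewrite ?nnegrE ?(ltW x0) ?(ltW D0).
  have -> : kappa / (4 * D `^ beta) * D `^ beta = kappa / 4.
    by field; rewrite gt_eqF// powR_gt0.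
  by rewrite ler_peMr ?divr_ge0 ?(ltW kappa0)// exprn_ege1.
apply: (le_trans (large Dx)); rewrite lee_fin ler_pM2l// ler_expR.
rewrite !mulNr lerN2 ler_wpM2r ?powR_ge0// ler_wpM2r ?ler0n//.
by rewrite ge_min lexx.
Qed.
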